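(* Let $X\subseteq\mathbb{R}^n$ be a finite union of hyperboxes, let $f:\mathbb{I}X\to\mathbb{I}\mathbb{R}^1_\bot$ be a Scott-continuous interval function, let $m_\iota,m_b\in\mathbb{N}$, and let $\delta\ge 0$ be a dyadic number. Then the interval maximization algorithm (described in the context), run on input $(f,X,m_\iota,m_b,\delta)$, halts in finite time and returns enclosures of $\operatorname{max_V}(f,X)$ and $\operatorname{max_S}(f,X)$; that is, if $(I,\hat B)$ is the returned pair, then $\operatorname{max_V}(f,X)\subseteq I$ and $\operatorname{max_S}(f,X)\subseteq\bigcup\hat B$.
   Context: $\mathbb{I}\mathbb{R}^1_\bot$ is the set of compact intervals $[a,b]\subseteq\mathbb{R}$ together with $\bot=\mathbb{R}$, ordered by reverse inclusion. $\mathbb{I}X$ is the set of hyperboxes $\prod_{i=1}^n[a_i,b_i]$ contained in $X$, ordered by reverse inclusion; points $x\in X$ are identified with the maximal elements $\{x\}$, and $f(x)$ means $f(\{x\})$. Scott-continuous means monotone and preserving suprema of directed sets. For an interval $I$ write $I=[\underline I,\overline I]$; for $\bot=\mathbb{R}$ the endpoints are $-\infty$ and $+\infty$. Maximum value and maximum set: $\operatorname{max_V}(f,X)=[\underline z,\overline z]$ with $\underline z=\sup_{x\in X}\underline{f(x)}$ and $\overline z=\sup_{x\in X}\overline{f(x)}$, and $\operatorname{max_S}(f,X)=\{x\in X\mid f(x)\cap\operatorname{max_V}(f,X)\ne\emptyset\}$. If infinite endpoints occur, the intersection is tested in the extended real line (so $x\in\operatorname{max_S}(f,X)$ iff $\overline{f(x)}\ge\underline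 z$), and an interval with $\overline z=+\infty$ is read as $\bot$ when regarded as an element of $\mathbb{I}\mathbb{R}^1_\bot$. The algorithm: set $i\leftarrow0$ and $B_1\leftarrow X$ (the given finite set of hyperboxes whose union is $X$). Repeat the following: (1) $i\leftarrow i+1$; (2) $L_i=\{f(b)\mid b\in B_i\}$, $\overline{z_i}=\max\{\overline I\mid I\in L_i\}$, $\underline{z_i}=\max\{\underline I\mid I\in L_i\}$, $I_i=[\underline{z_i},\overline{z_i}]$; (3) $\hat B_i=\{b\in B_i\mid \underline{z_i}\in f(b)\}$; (4) if $2^n|\hat B_i|<m_b$, then $B_{i+1}$ is the set of boxes obtained by bisecting every box of $\hat B_i$ along all $n$ coordinates (each box yields $2^n$ boxes); until $i\ge m_\iota$ or $2^n|\hat B_i|\ge m_b$ or $\overline{z_i}-\underline{z_i}\le\delta$. Return $(I_i,\hat B_i)$. *)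

(* Defs.v *)
From HB Require Import structures.
From mathcomp Require Import all_boot all_order all_algebra.
From mathcomp Require Import finmap.
From mathcomp Require Import boolp classical_sets reals ereal.

Set Implicit Arguments.
Unset Strict Implicit.
Unset Printing Implicit Defensive.

Import Order.TTheory GRing.Theory Num.Theory.

Local Open Scope classical_set_scope.
Local Open Scope ring_scope.

Fact infoorder_display : Order.disp_t. Proof. exact: Order.Disp tt tt. Qed.

(* A hyperbox [a, b] = prod_i [a_i, b_i] of R^n, given by the pair (a, b).
   Hyperboxes are nonempty but may be degenerate (a_i = b_i). *)
Record box (R : realType) (n : nat) := Box {
  box_ends : 'rV[R]_n * 'rV[R]_n;
  _ : [forall i, box_ends.1 ord0 i <= box_ends.2 ord0 i] }.

HB.instance Definition _ (R : realType) n := [isSub for @box_ends R n].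
HB.instance Definition _ (R : realType) n := [Choice of box R n by <:].

Definition box_set (R : realType) n (b : box R n) : set 'rV[R]_n :=
  [set x | forall i, (box_ends b).1 ord0 i <= x ord0 i <= (box_ends b).2 ord0 i].

Lemma box_lower_in (R : realType) n (b : box R n) : box_set b (box_ends b).1.
Proof. by move=> i; rewrite lexx; case: b => e /= /forallP. Qed.

Lemma box_upper_in (R : realType) n (b : box R n) : box_set b (box_ends b).2.
Proof. by move=> i; rewrite lexx andbT; case: b => e /= /forallP. Qed.

Lemma box_set_inj (R : realType) n : injective (@box_set R n).
Proof.
move=> b c E; have bl := box_lower_in b; have bu := box_upper_in b.
have cl := box_lower_in c; have cu := box_upper_in c.
rewrite E in bl bu; rewrite -E in cl cu; apply: val_inj => /=.
rewrite [LHS]surjective_pairing [RHS]surjective_pairing.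
congr pair; apply/rowP => i; apply/eqP; rewrite eq_le.
  by case/andP: (bl i) => ->; case/andP: (cl i) => ->.
by case/andP: (bu i) => _ ->; case/andP: (cu i) => _ ->.
Qed.

Definition box_le (R : realType) n (b c : box R n) : bool :=
  `[< box_set c `<=` box_set b >].

Fact box_le_refl (R : realType) n : reflexive (@box_le R n).
Proof. by move=> b; apply/asboolP. Qed.

Fact box_le_anti (R : realType) n : antisymmetric (@box_le R n).
Proof.
move=> b c /andP[/asboolP cb /asboolP bc].
by apply: box_set_inj; apply/seteqP; split.
Qed.

Fact box_le_trans (R : realType) n : transitive (@box_le R n).
Proof.
move=> c b d /asboolP cb /asboolP dc; apply/asboolP.
exact: subset_trans dc cb.
Qed.

HB.instance Definition _ (R : realType) n :=
  Order.Le_isPOrder.Build infoorder_display (box R n)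
    (@box_le_refl R n) (@box_le_anti R n) (@box_le_trans R n).

(* IX : the hyperboxes contained in X, ordered by reverse inclusion. *)
Record ibox (R : realType) (n : nat) (X : set 'rV[R]_n) := IBox {
  ibox_box :> box R n;
  _ : `[< box_set ibox_box `<=` X >] }.

HB.instance Definition _ (R : realType) n (X : set 'rV[R]_n) :=
  [isSub for @ibox_box R n X].
HB.instance Definition _ (R : realType) n (X : set 'rV[R]_n) :=
  [Choice of ibox X by <:].
HB.instance Definition _ (R : realType) n (X : set 'rV[R]_n) :=
  [SubChoice_isSubPOrder of ibox X by <: with infoorder_display].

Lemma ibox_sub (R : realType) n (X : set 'rV[R]_n) (b : ibox X) :
  box_set b `<=` X.
Proof. by case: b => b /= /asboolP. Qed.

Fact point_box_subproof (R : realType) n (x : 'rV[R]_n) :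
  [forall i, (x, x).1 ord0 i <= (x, x).2 ord0 i].
Proof. by apply/forallP => i /=. Qed.

Definition point_box (R : realType) n (x : 'rV[R]_n) : box R n :=
  Box (point_box_subproof x).

Lemma point_box_set (R : realType) n (x : 'rV[R]_n) :
  box_set (point_box x) = [set x].
Proof.
apply/seteqP; split => [y /= xy|y -> i /=]; last by rewrite lexx.
by apply/rowP => i; apply/eqP; rewrite eq_le andbC; exact: xy.
Qed.

Fact point_subproof (R : realType) n (X : set 'rV[R]_n) (x : X) :
  `[< box_set (point_box (val x)) `<=` X >].
Proof. by apply/asboolP; rewrite point_box_set => y ->; exact: set_valP. Qed.

(* The maximal element {x} of IX. *)
Definition ipoint (R : realType) n (X : set 'rV[R]_n) (x : X) : ibox X :=
  IBox (point_subproof x).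

(* IR^1_bot : the compact intervals [a, b], and [None] for bot = R. *)
Record citv (R : realType) := CItv {
  citv_ends : R * R;
  _ : citv_ends.1 <= citv_ends.2 }.

HB.instance Definition _ (R : realType) := [isSub for @citv_ends R].
HB.instance Definition _ (R : realType) := [Choice of citv R by <:].

Definition IRbot (R : realType) := option (citv R).

HB.instance Definition _ (R : realType) := Choice.on (IRbot R).

Definition IRbot_set (R : realType) (I : IRbot R) : set R :=
  if I is Some J
  then [set y | (citv_ends J).1 <= y <= (citv_ends J).2] else [set: R].

Lemma IRbot_set_inj (R : realType) : injective (@IRbot_set R).
Proof.
have L (J : citv R) : IRbot_set (Some J) (citv_ends J).1.
  by case: J => e /= h; rewrite lexx.
have U (J : citv R) : IRbot_set (Some J) (citv_ends J).2.
  by case: J => e /= h; rewrite lexx andbT.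
have NT (J : citv R) : IRbot_set (Some J) <> [set: R].
  move=> E; have : IRbot_set (Some J) ((citv_ends J).2 + 1) by rewrite E.
  by move=> /= /andP[_]; rewrite gerDl ler10.
move=> [J|] [K|] //; [|by move/NT|by move/esym/NT].
move=> E; have JL := L J; have JU := U J; have KL := L K; have KU := U K.
rewrite E in JL JU; rewrite -E in KL KU; congr Some; apply: val_inj => /=.
rewrite [LHS]surjective_pairing [RHS]surjective_pairing.
move: JL JU KL KU => /= /andP[ca _] /andP[_ bd] /andP[ac _] /andP[_ db].
by congr pair; apply/eqP; rewrite eq_le ?ca ?ac ?bd ?db.
Qed.

Definition IRbot_le (R : realType) (I J : IRbot R) : bool :=
  `[< IRbot_set J `<=` IRbot_set I >].

Fact IRbot_le_refl (R : realType) : reflexive (@IRbot_le R).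
Proof. by move=> I; apply/asboolP. Qed.

Fact IRbot_le_anti (R : realType) : antisymmetric (@IRbot_le R).
Proof.
move=> I J /andP[/asboolP JI /asboolP IJ].
by apply: IRbot_set_inj; apply/seteqP; split.
Qed.

Fact IRbot_le_trans (R : realType) : transitive (@IRbot_le R).
Proof.
move=> J I K /asboolP JI /asboolP KJ; apply/asboolP.
exact: subset_trans KJ JI.
Qed.

HB.instance Definition _ (R : realType) :=
  Order.Le_isPOrder.Build infoorder_display (IRbot R)
    (@IRbot_le_refl R) (@IRbot_le_anti R) (@IRbot_le_trans R).

Definition lowend (R : realType) (I : IRbot R) : \bar R :=
  if I is Some J then ((citv_ends J).1)%:E else -oo%E.

Definition upend (R : realType) (I : IRbot R) : \bar R :=
  if I is Some J then ((citv_ends J).2)%:E else +oo%E.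

(* An interval as a subset of the extended real line; bot is [-oo, +oo]. *)
Definition ext_itv (R : realType) (I : IRbot R) : interval (\bar R) :=
  `[lowend I, upend I].

Definition directed (d : Order.disp_t) (T : porderType d) (D : set T) : Prop :=
  D !=set0 /\
  forall x y, D x -> D y -> exists z, [/\ D z, (x <= z)%O & (y <= z)%O].

Definition scott_continuous (d d' : Order.disp_t)
    (T : porderType d) (T' : porderType d') (f : T -> T') : Prop :=
  {homo f : x y / (x <= y)%O} /\
  forall (D : set T) (s : T),
    directed D -> supremums D s -> supremums (f @` D) (f s).

Definition dyadic (R : realType) (x : R) : Prop :=
  exists (m : int) (k : nat), x = m%:~R / 2 ^+ k.

(* Endpoints live in the extended real line: both suprema may be infinite. *)
Definition maxV (R : realType) n (X : set 'rV[R]_n) (f : ibox X -> IRbot R) :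
    interval (\bar R) :=
  `[ ereal_sup (range (fun x : X => lowend (f (ipoint x)))),
     ereal_sup (range (fun x : X => upend (f (ipoint x)))) ].

Definition maxS (R : realType) n (X : set 'rV[R]_n) (f : ibox X -> IRbot R) :
    set 'rV[R]_n :=
  [set val x | x in
    [set x : X | [set` ext_itv (f (ipoint x))] `&` [set` maxV f] !=set0]].

(* One of the 2^n boxes obtained by bisecting b along all coordinates: s i says
   whether the upper or the lower half is kept along coordinate i. *)
Definition half_ends (R : realType) n (b : box R n) (s : {ffun 'I_n -> bool}) :
    'rV[R]_n * 'rV[R]_n :=
  let lo i := (box_ends b).1 ord0 i in
  let hi i := (box_ends b).2 ord0 i in
  let mid i := (lo i + hi i) / 2 in
  (\row_i (if s i then mid i else lo i), \row_i (if s i then hi i else mid i)).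

Fact half_box_subproof (R : realType) n (b : box R n) (s : {ffun 'I_n -> bool}) :
  [forall i, (half_ends b s).1 ord0 i <= (half_ends b s).2 ord0 i].
Proof.
apply/forallP => i; case: b => -[a b] /= /forallP /= ab; rewrite !mxE /=.
by case: (s i); rewrite (midf_le (ab i)).
Qed.

Definition half_box (R : realType) n (b : box R n) (s : {ffun 'I_n -> bool}) :
    box R n :=
  Box (half_box_subproof b s).

Lemma half_box_sub (R : realType) n (b : box R n) (s : {ffun 'I_n -> bool}) :
  box_set (half_box b s) `<=` box_set b.
Proof.
move=> x xs i; move: (xs i); case: b {xs} => -[a b] /= /forallP /= ab.
rewrite !mxE /=; have [l u] := midf_le (ab i).
case: (s i) => /andP[lx xu]; apply/andP; split => //.
  exact: le_trans l lx.
exact: le_trans xu u.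
Qed.

Fact half_subproof (R : realType) n (X : set 'rV[R]_n) (b : ibox X)
  (s : {ffun 'I_n -> bool}) : `[< box_set (half_box b s) `<=` X >].
Proof.
by apply/asboolP; apply: subset_trans (@half_box_sub _ _ _ _) (@ibox_sub _ _ _ b).
Qed.

Definition ihalf (R : realType) n (X : set 'rV[R]_n) (b : ibox X)
    (s : {ffun 'I_n -> bool}) : ibox X :=
  IBox (half_subproof b s).

Definition bisect (R : realType) n (X : set 'rV[R]_n) (B : {fset ibox X}) :
    {fset ibox X} :=
  [fset ihalf b s | b in B, s in {: {ffun 'I_n -> bool}}]%fset.

(* Maxima over a finite set of intervals; the maximum of the empty set is
   its supremum -oo. *)
Definition max_up (R : realType) (L : {fset IRbot R}) : \bar R :=
  \big[Order.max/-oo%E]_(I <- L) upend I.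

Definition max_low (R : realType) (L : {fset IRbot R}) : \bar R :=
  \big[Order.max/-oo%E]_(I <- L) lowend I.

Section Algorithm.
Variables (R : realType) (n : nat) (X : set 'rV[R]_n).
Variables (f : ibox X -> IRbot R) (m_iota m_b : nat) (delta : R).

Definition values (B : {fset ibox X}) : {fset IRbot R} := [fset f b | b in B]%fset.

Definition max_itv (B : {fset ibox X}) : interval (\bar R) :=
  `[max_low (values B), max_up (values B)].

Definition survivors (B : {fset ibox X}) : {fset ibox X} :=
  [fset b in B | max_low (values B) \in ext_itv (f b)]%fset.

Definition next_boxes (B : {fset ibox X}) : {fset ibox X} :=
  if (2 ^ n * #|` survivors B| < m_b)%N then bisect (survivors B) else B.

Definition stop (i : nat) (B : {fset ibox X}) : bool :=
  [|| (m_iota <= i)%N,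
      (m_b <= 2 ^ n * #|` survivors B|)%N |
      (max_up (values B) - max_low (values B) <= delta%:E)%E].

Definition result : Type := interval (\bar R) * {fset ibox X}.

(* One pass through the loop body, from a state (i, B): either the loop is left
   with a result, or it is entered again in a new state. *)
Definition iteration (st : nat * {fset ibox X}) :
    result + nat * {fset ibox X} :=
  let: (i, B) := st in
  if stop i.+1 B then inl (max_itv B, survivors B)
  else inr (i.+1, next_boxes B).

(* At most k passes through the loop; [None] if it has not been left by then. *)
Fixpoint run (k : nat) (st : nat * {fset ibox X}) : option result :=
  if k is k'.+1 then
    match iteration st with
    | inl r => Some r
    | inr st' => run k' st'
    end
  else None.

Definition returns (B1 : {fset ibox X}) (r : result) : Prop :=
  exists k, run k (0, B1)%N = Some r.

End Algorithm.

(* Main.v *)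
(* A box b is discarded only when the upper endpoint of f(b) lies strictly below
   the largest lower endpoint, which is attained on a box that survives.  As f
   is monotone, every point x of X is therefore either still covered by the
   current boxes or strictly dominated by a covered point y, in the sense that
   the upper endpoint of f(x) lies below the lower endpoint of f(y).  This
   invariant bounds the values at the discarded points and shows that none of
   them belongs to the maximum set.  Termination is forced by the bound on the
   number of iterations. *)
Require Import Defs.
From mathcomp Require Import all_boot all_order all_algebra.
From mathcomp Require Import finmap.
From mathcomp Require Import boolp classical_sets reals ereal.

Set Implicit Arguments.
Unset Strict Implicit.
Unset Printing Implicit Defensive.

Import Order.TTheory GRing.Theory Num.Theory.

Local Open Scope classical_set_scope.
Local Open Scope ring_scope.

Lemma lowend_le_upend (R : realType) (I : IRbot R) : (lowend I <= upend I)%E.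
Proof. by case: I => [[e h]|] //=; rewrite lee_fin. Qed.

Lemma IRbot_le_ends (R : realType) (I J : IRbot R) :
  (I <= J)%O -> (lowend I <= lowend J)%E /\ (upend J <= upend I)%E.
Proof.
move=> /asboolP; case: I => [I|] JI; last by rewrite leNye leey.
case: J JI => [[[a b] /= ab]|] JI.
  have /JI /= /andP[la _] : IRbot_set (Some (@CItv R (a, b) ab)) a by rewrite /= lexx.
  have /JI /= /andP[_ bu] : IRbot_set (Some (@CItv R (a, b) ab)) b.
    by rewrite /= lexx andbT.
  by rewrite !lee_fin.
(* No compact interval contains [bot]: its upper endpoint plus one escapes it. *)
have /= /andP[_] := JI ((citv_ends I).2 + 1) Logic.I.
by rewrite gerDl ler10.
Qed.

Lemma ibox_le_ipoint (R : realType) (n : nat) (X : set 'rV[R]_n) (b : ibox X)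
  (x : X) : box_set b (val x) -> (b <= ipoint x)%O.
Proof. by move=> bx; apply/asboolP => y; rewrite point_box_set => ->. Qed.

Definition cover (R : realType) (n : nat) (X : set 'rV[R]_n)
    (B : {fset ibox X}) : set 'rV[R]_n :=
  \bigcup_(b in [set` B]) box_set b.

Lemma cover_bisect (R : realType) (n : nat) (X : set 'rV[R]_n)
  (B : {fset ibox X}) : cover B `<=` cover (bisect B).
Proof.
move=> x [b /= bB bx].
pose mid i := ((box_ends b).1 ord0 i + (box_ends b).2 ord0 i) / 2.
(* Keep the upper half exactly in the coordinates where [x] reaches the midpoint; the chosen box
   then contains [x]. *)
pose s := [ffun i => mid i <= x ord0 i].
exists (ihalf b s); first by apply/imfset2P; exists b => //; exists s.
move=> i /=; rewrite !mxE ffunE; have /andP[l u] := bx i.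
by case: (leP (mid i) (x ord0 i)) => m; apply/andP; split=> //; exact: ltW.
Qed.

Section Enclosure.
Variables (R : realType) (n : nat) (X : set 'rV[R]_n).
Variable f : ibox X -> IRbot R.
Implicit Types (B : {fset ibox X}) (b : ibox X) (x y : X).

Lemma lowend_le_max_low B b :
  b \in B -> (lowend (f b) <= max_low (values f B))%E.
Proof. by move=> bB; apply: le_bigmax_seq => //; exact: in_imfset. Qed.

Lemma upend_le_max_up B b : b \in B -> (upend (f b) <= max_up (values f B))%E.
Proof. by move=> bB; apply: le_bigmax_seq => //; exact: in_imfset. Qed.

(** The member [b] makes [B] nonempty, so the maximum is a genuine lower endpoint and not just the
    default [-oo]. *)
Lemma max_low_attained B b :
  b \in B -> exists2 c, c \in B & lowend (f c) = max_low (values f B).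
Proof.
move=> bB; have fbB : f b \in values f B by exact: in_imfset.
have attained (I : IRbot R) (s : seq (IRbot R)) : exists2 J, J \in I :: s
    & lowend J = \big[Order.max/-oo%E]_(K <- I :: s) lowend K.
  elim: s I => [|K s IHs] I; first by exists I; rewrite ?mem_head// big_seq1.
  have [J Js JE] := IHs K; rewrite big_cons -JE.
  case: (leP (lowend I) (lowend J)) => _.
    by exists J; rewrite // in_cons Js orbT.
  by exists I; rewrite ?mem_head.
suff [I /imfsetP[c /= cB ->] IE] :
    exists2 I, I \in values f B & lowend I = max_low (values f B) by exists c.
have : f b \in enum_fset (values f B) by [].
rewrite /max_low; case E : (enum_fset (values f B)) => [//|I s] _.
have [J JIs JE] := attained I s; exists J => //.
by change (J \in enum_fset (values f B)); rewrite E.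
Qed.

(** For a box of [B] the lower half of the interval test is automatic, since [max_low] bounds every
    lower endpoint. *)
Lemma in_survivors B b :
  (b \in survivors f B) =
  (b \in B) && (max_low (values f B) <= upend (f b))%E.
Proof.
rewrite !inE /= /ext_itv subitvE /= !bnd_simp.
by case: (boolP (b \in B)) => //= bB; rewrite lowend_le_max_low.
Qed.

(** The loop invariant. It speaks of points because bisection replaces the boxes but keeps their
    union covered. *)
Definition undominated_covered B : Prop :=
  forall x, cover B (val x) \/
    exists2 y, cover B (val y)
             & (upend (f (ipoint x)) < lowend (f (ipoint y)))%E.

Lemma undominated_coveredS B C :
  cover B `<=` cover C -> undominated_covered B -> undominated_covered C.
Proof.
move=> BC hB x; case: (hB x) => [/BC|[y /BC yC xy]]; first by left.
by right; exists y.
Qed.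

Hypothesis f_homo : {homo f : b c / (b <= c)%O}.

Lemma lowend_ipoint b x :
  box_set b (val x) -> (lowend (f b) <= lowend (f (ipoint x)))%E.
Proof. by move=> /ibox_le_ipoint/f_homo/IRbot_le_ends[]. Qed.

Lemma upend_ipoint b x :
  box_set b (val x) -> (upend (f (ipoint x)) <= upend (f b))%E.
Proof. by move=> /ibox_le_ipoint/f_homo/IRbot_le_ends[]. Qed.

Lemma box_has_point b : exists x : X, box_set b (val x).
Proof.
have l := box_lower_in b.
by exists (SigSub (mem_set (ibox_sub l))).
Qed.

Lemma undominated_survivors B :
  undominated_covered B -> undominated_covered (survivors f B).
Proof.
have step x : cover B (val x) -> cover (survivors f B) (val x) \/
    exists2 y, cover (survivors f B) (val y)
             & (upend (f (ipoint x)) < lowend (f (ipoint y)))%E.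
  move=> [b /= bB bx].
  case: (leP (max_low (values f B)) (upend (f b))) => [bS|b_lt].
    by left; exists b => //=; rewrite in_survivors bB.
  (* With [c] attaining the maximum, upend f(x) <= upend f(b) < lowend f(c) <= lowend f(y) for any
     point [y] of [c]. *)
  right; have [c cB cE] := max_low_attained bB; have [y cy] := box_has_point c.
  exists y; last first.
    apply: le_lt_trans (upend_ipoint bx) _; apply: lt_le_trans b_lt _.
    by rewrite -cE lowend_ipoint.
  by exists c => //=; rewrite in_survivors cB -cE lowend_le_upend.
move=> hB x; case: (hB x) => [/step//|[y /step[yS|[z zS yz]] xy]].
  by right; exists y.
(* The dominating point [y] was itself discarded; domination is transitive because lowend f(y) <=
   upend f(y). *)
right; exists z => //; apply: lt_trans xy _.
exact: le_lt_trans (lowend_le_upend _) yz.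
Qed.

Lemma maxV_sub_max_itv B :
  undominated_covered B -> [set` maxV f] `<=` [set` max_itv f B].
Proof.
have upB y : cover B (val y) ->
    (upend (f (ipoint y)) <= max_up (values f B))%E.
  by move=> [b /= bB /upend_ipoint/le_trans]; apply; exact: upend_le_max_up.
move=> hB t; rewrite /maxV /max_itv /= !in_itv/= => /andP[lt tu].
apply/andP; split.
  apply: le_trans lt; rewrite /max_low big_seq.
  (* Each lower endpoint on a box is at most the one at a point of that box, hence at most the
     supremum over [X]. *)
  apply: bigmax_le => [|I /imfsetP[b /= bB ->]]; first exact: leNye.
  have [x bx] := box_has_point b.
  by apply: le_trans (lowend_ipoint bx) _; apply: ereal_sup_ubound; exists x.
apply: (le_trans tu); apply: ge_ereal_sup => _ [x _ <-].
case: (hB x) => [/upB//|[y /upB yB xy]].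
by apply: ltW; apply: lt_le_trans xy (le_trans (lowend_le_upend _) yB).
Qed.

(** If [y] dominates [x], a common point [t] of f(x) and [maxV f] would satisfy t <= upend f(x) <
    lowend f(y) <= t. *)
Lemma maxS_sub_cover B : undominated_covered B -> maxS f `<=` cover B.
Proof.
move=> hB _ [x [t [/= tx lt]] <-]; move: tx lt.
rewrite /ext_itv /maxV !in_itv/= => /andP[_ tx] /andP[lt _]; case: (hB x) => [//|[y _ xy]].
suff /lt_le_trans /(_ lt) : (t < ereal_sup (range (fun z : X =>
    lowend (f (ipoint z)))))%E by rewrite ltxx.
apply: lt_le_trans (le_lt_trans tx xy) _.
by apply: ereal_sup_ubound; exists y.
Qed.

Lemma undominated_next_boxes (m_b : nat) B :
  undominated_covered B -> undominated_covered (next_boxes f m_b B).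
Proof.
rewrite /next_boxes; case: ifP => // _ /undominated_survivors.
exact/undominated_coveredS/cover_bisect.
Qed.

Lemma run_enclosure (m_iota m_b : nat) (delta : R) (k i : nat) B
  (I : interval (\bar R)) (Bhat : {fset ibox X}) :
  undominated_covered B ->
  run f m_iota m_b delta k (i, B) = Some (I, Bhat) ->
  [set` maxV f] `<=` [set` I] /\ maxS f `<=` cover Bhat.
Proof.
elim: k i B => //= k IHk i B hB; case: ifP => _.
  move=> [<- <-]; split; first exact: maxV_sub_max_itv.
  (* The returned interval comes from [B], but the returned boxes are its survivors: the invariant
     must pass one more filtering. *)
  exact/maxS_sub_cover/undominated_survivors.
exact/IHk/undominated_next_boxes.
Qed.

End Enclosure.

(** The counter grows at each pass until it meets [m_iota]. The fuel is [k.+1] since one pass is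
    made even when [m_iota <= i] already. *)
Lemma run_halts (R : realType) (n : nat) (X : set 'rV[R]_n)
  (f : ibox X -> IRbot R) (m_iota m_b : nat) (delta : R) (k i : nat)
  (B : {fset ibox X}) :
  (m_iota <= i + k)%N -> exists r, run f m_iota m_b delta k.+1 (i, B) = Some r.
Proof.
elim: k i B => [|k IHk] i B le_ik.
  by rewrite addn0 in le_ik; rewrite /= /stop (leqW le_ik); eexists.
rewrite [run _ _ _ _ _ _]/=; case: ifP => _; first by eexists.
by apply: IHk; rewrite addSnnS.
Qed.

Theorem lemma4p12 (R : realType) (n : nat) (X : set 'rV[R]_n)
  (B1 : {fset ibox X}) (hX : X = \bigcup_(b in [set` B1]) box_set b)
  (f : ibox X -> IRbot R) (hf : scott_continuous f)
  (m_iota m_b : nat) (delta : R) (hdelta : 0 <= delta)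
  (hdyadic : dyadic delta) :
  (exists r : result X, returns f m_iota m_b delta B1 r) /\
  (forall (I : interval (\bar R)) (Bhat : {fset ibox X}),
     returns f m_iota m_b delta B1 (I, Bhat) ->
     [set` maxV f] `<=` [set` I] /\
     maxS f `<=` \bigcup_(b in [set` Bhat]) box_set b).
Proof.
split.
  have [r hr] := @run_halts R n X f m_iota m_b delta m_iota 0 B1 (leqnn _).
  by exists r, m_iota.+1.
(* The initial boxes cover [X], so the invariant starts with its first alternative at every
   point. *)
have XB x : X x -> cover B1 x by move: (B1) hX => B E; rewrite {1}E.
move=> I Bhat [k]; apply: run_enclosure; first by case: hf.
by move=> x; left; apply: XB; exact: set_valP.
Qed.
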